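(* Let $A$ and $B$ be unital locally matrix algebras over a field $\mathbb{F}$ whose characteristic is not $2$. Let $\varphi : A \to B$ be an $\mathbb{F}$-linear mapping that preserves the normalized rank. Then there exist orthogonal idempotents $e_1, e_2 \in B$ with $e_1 + e_2 = 1_B$; a homomorphism $\varphi_1 : A \to e_1 B e_1$ with $\varphi_1(1_A) = e_1$; an antihomomorphism $\varphi_2 : A \to e_2 B e_2$ with $\varphi_2(1_A) = e_2$; and invertible elements $X, Y \in B$ such that $$\varphi(a) = X \bigl( \varphi_1(a) + \varphi_2(a) \bigr) Y \quad \text{for all } a \in A.$$
   Context: An associative $\mathbb{F}$-algebra $A$ is a locally matrix algebra if every finite subset of $A$ is contained in a subalgebra isomorphic to a matrix algebra $M_n(\mathbb{F})$ for some $n$; it is unital if it contains an identity element $1_A$. Normalized rank: let $A$ be a unital locally matrix algebra. For $a \in A$ choose a subalgebra $A' \subset A$ containing $1_A$ and $a$ with $A' \cong M_n(\mathbb{F})$; put $\overline{r}(a) = r(a)/n$, where $r(a)$ is the rank of $a$ as an $n\times n$ matrix. This does not depend on the choice of $A'$. A linear mapping $\varphi: A \to B$ of unital locally matrix algebras preserves the normalized rank if $\overline{r}(\varphi(a)) = \overline{r}(a)$ for all $a \in A$. An antihomomorphism $\psi : A \to B$ of associative algebras is a linear mapping with $\psi(a_1 a_2) = \psi(a_2)\psi(a_1)$ for all $a_1, a_2 \in A$. The idempotents $e_1, e_2$ are allowed to be zero. *)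

(* Defs.v *)
From HB Require Import structures.
From mathcomp Require Import all_boot all_order all_algebra.
From mathcomp Require Import boolp classical_sets.

Set Implicit Arguments.
Unset Strict Implicit.
Unset Printing Implicit Defensive.

Import GRing.Theory.

Local Open Scope classical_set_scope.
Local Open Scope ring_scope.

(* The subalgebras of A isomorphic to M_n(F) are exactly the ranges of the maps
   f below. Such a subalgebra need not contain 1_A: f 1%:M is only required to
   be an idempotent, by multiplicativity. *)
Definition matrix_embedding (F : fieldType) (A : algType F) (n : nat)
    (f : {linear 'M[F]_n -> A}) : Prop :=
  injective f /\ {morph f : M N / M *m N >-> M * N}.

Definition locally_matrix (F : fieldType) (A : algType F) : Prop :=
  forall s : seq A, exists n : nat, exists f : {linear 'M[F]_n -> A},
    [/\ (0 < n)%N, matrix_embedding f & forall a, a \in s -> range f a].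

Definition is_nrank (F : fieldType) (A : algType F) (a : A) (q : rat) : Prop :=
  exists n : nat, exists f : {linear 'M[F]_n -> A}, exists M : 'M[F]_n,
    [/\ (0 < n)%N, matrix_embedding f, range f 1, f M = a
      & q = (\rank M)%:R / n%:R].

(* When A is locally matrix there is exactly one q with [is_nrank a q], so the
   value is independent of the choice made by [xget], and the default 0 is
   never used. *)
Definition nrank (F : fieldType) (A : algType F) (a : A) : rat :=
  xget 0 [set q | is_nrank a q].

Definition preserves_nrank (F : fieldType) (A B : algType F)
    (phi : {linear A -> B}) : Prop :=
  forall a : A, nrank (phi a) = nrank a.

Definition corner (F : fieldType) (B : algType F) (e : B) : set B :=
  [set e * b * e | b in [set: B]].

(* Homomorphisms into the corner e B e, whose identity is e, are given as maps
   to B with values in the corner; e = 0 is allowed. *)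
Definition corner_hom (F : fieldType) (A B : algType F) (e : B)
    (psi : {linear A -> B}) : Prop :=
  (forall a, corner e (psi a)) /\ {morph psi : a b / a * b >-> a * b}.

Definition corner_antihom (F : fieldType) (A B : algType F) (e : B)
    (psi : {linear A -> B}) : Prop :=
  (forall a, corner e (psi a)) /\ {morph psi : a b / a * b >-> b * a}.

Definition invertible (F : fieldType) (B : algType F) (x : B) : Prop :=
  exists y : B, x * y = 1 /\ y * x = 1.

Definition orthogonal_idempotents (F : fieldType) (B : algType F)
    (e1 e2 : B) : Prop :=
  [/\ e1 * e1 = e1, e2 * e2 = e2, e1 * e2 = 0 & e2 * e1 = 0].

(* Main.v *)
Require Import Defs.
From HB Require Import structures.
From mathcomp Require Import all_boot all_order all_algebra.
From mathcomp Require Import boolp classical_sets.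

Set Implicit Arguments.
Unset Strict Implicit.
Unset Printing Implicit Defensive.

Import GRing.Theory.

Local Open Scope ring_scope.

(* The elements [1] and [phi 1] have normalized rank 1, so [phi 1] is invertible
   and [psi a := phi a * (phi 1)^-1] is unital. An element [a] of a matrix
   algebra is idempotent iff the ranks of [a] and [1 - a] add up to the size,
   hence [psi] preserves idempotents; in characteristic not 2 it follows that the
   images [x i j] of the matrix units of any unital matrix subalgebra multiply
   like matrix units for the Jordan product. With [p i := x i i], the Peirce
   components of [x i j] in [p i B p j] form a system of matrix units, those in
   [p j B p i] form one of the converse ring, and the sum [e] of the diagonal of
   the first system cuts [psi] into a homomorphism [e psi] and an antihomomorphism
   [(1 - e) psi]. This [e] is unique as soon as the subalgebra has size at least
   2, so the same [e] works for all larger subalgebras, and hence on A. *)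

(** * Ranks of matrices: idempotents and unital multiplicative maps *)

Lemma mxrank_idem_compl (F : fieldType) n (P : 'M[F]_n) :
  P *m P = P -> (\rank P + \rank (1%:M - P)%R = n)%N.
Proof.
move=> PP; apply/eqP; rewrite eqn_leq mulmx0_rank_max ?mulmxBr ?mulmx1 ?PP ?subrr //=.
by rewrite -{1}(mxrank1 F n) -{1}(subrK P 1%:M) addrC mxrank_add.
Qed.

(** The row spaces of [P] and [1 - P] always span everything, so complementary ranks force them to
    meet in 0; the rows of [P - P *m P] lie in both. *)
Lemma idem_of_mxrank_compl (F : fieldType) n (P : 'M[F]_n) :
  (\rank P + \rank (1%:M - P)%R = n)%N -> P *m P = P.
Proof.
move=> rk; have full : \rank (P + (1%:M - P)%R)%MS = n.
  apply/eqP; rewrite eqn_leq rank_leq_row /= -{1}(mxrank1 F n) mxrankS //.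
  by rewrite -{1}(subrK P 1%:M) addrC addmx_sub_adds.
have := mxrank_sum_cap P (1%:M - P); rewrite full rk.
move/eqP; rewrite -[X in _ == X]addn0 eqn_add2l mxrank_eq0 => /eqP cap0.
suff: (P - P *m P <= P :&: (1%:M - P)%R)%MS.
  by rewrite cap0 submx0 subr_eq0 => /eqP.
rewrite sub_capmx; apply/andP; split.
  by rewrite -{1}(mul1mx P) -mulmxBl submxMl.
by rewrite -{1}(mulmx1 P) -mulmxBr submxMl.
Qed.

Lemma mxrank_add_orth_idem (F : fieldType) n (P Q : 'M[F]_n) :
  P *m P = P -> Q *m Q = Q -> P *m Q = 0 -> Q *m P = 0 ->
  \rank (P + Q)%R = (\rank P + \rank Q)%N.
Proof.
move=> PP QQ PQ QP; apply/eqP; rewrite eqn_leq mxrank_add /=.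
have cap0 : (P :&: Q)%MS = 0.
  apply/eqP; rewrite -submx0.
  have /submxP[C1 e1] := capmxSl P Q; have /submxP[C2 e2] := capmxSr P Q.
  have : (P :&: Q)%MS *m P = (P :&: Q)%MS by rewrite {1}e1 -mulmxA PP -e1.
  by rewrite {1}e2 -mulmxA QP mulmx0 => <-; apply: sub0mx.
rewrite -(mxrank_disjoint_sum cap0) mxrankS // addsmx_sub; apply/andP; split.
  by rewrite -{1}PP -[P *m P]addr0 -PQ -mulmxDr submxMl.
by rewrite -{1}QQ -[Q *m Q]add0r -QP -mulmxDr submxMl.
Qed.

Lemma pid_mxS (R : pzRingType) n (i : 'I_n) :
  pid_mx i.+1 = pid_mx i + delta_mx i i :> 'M[R]_n.
Proof.
apply/matrixP=> a b; rewrite !mxE -!val_eqE /= -natrD; congr (_%:R).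
by rewrite ltnS; case: (eqVneq (a : nat) b) => [<-|ne_ab];
  case: (ltngtP a i) => // eq_ai; rewrite -eq_ai eq_sym (negPf ne_ab).
Qed.

Lemma mxrank_mulmx_unit (F : fieldType) n (L L' U U' P : 'M[F]_n) :
  L' *m L = 1%:M -> U *m U' = 1%:M -> \rank (L *m P *m U) = \rank P.
Proof.
move=> LL UU; apply/eqP; rewrite eqn_leq; apply/andP; split.
  exact: leq_trans (mxrankM_maxl _ _) (mxrankM_maxr _ _).
have {1}-> : P = L' *m (L *m P *m U) *m U'.
  by rewrite !mulmxA LL mul1mx -mulmxA UU mulmx1.
exact: leq_trans (mxrankM_maxl _ _) (mxrankM_maxr _ _).
Qed.

(** This makes the normalized rank independent of the chosen subalgebra. The images of the diagonal
    units factor through one another, so they share a rank [d]; orthogonality gives [t (pid_mx r)]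
    rank [r * d], and [r = n] yields [k = n * d]. A general [M] is a [pid_mx] between two invertible
    matrices, whose images are invertible. *)
Lemma mxrank_unital_morph (F : fieldType) n k (t : 'M[F]_n -> 'M[F]_k) :
    {morph t : M N / M + N >-> M + N} -> {morph t : M N / M *m N >-> M *m N} ->
    t 1%:M = 1%:M ->
  forall M, (n * \rank (t M) = k * \rank M)%N.
Proof.
move=> tD tM t1 M; case: n => [|n] in t tD tM t1 M *.
  by rewrite (flatmx0 M) mxrank0 muln0.
have t0 : t 0 = 0 by apply: (addrI (t 0)); rewrite -tD !addr0.
set E := fun i : 'I_n.+1 => delta_mx i i : 'M[F]_n.+1.
set d := \rank (t (E ord0)).
have tE i : \rank (t (E i)) = d.
  suff le a b : (\rank (t (E a)) <= \rank (t (E b)))%N.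
    by apply/eqP; rewrite eqn_leq !le.
  have -> : E a = delta_mx a b *m E b *m delta_mx b a by rewrite !mul_delta_mx.
  rewrite !tM.
  exact: leq_trans (mxrankM_maxl _ _) (mxrankM_maxr _ _).
have tpid r : (r <= n.+1)%N -> \rank (t (pid_mx r)) = (r * d)%N.
  elim: r => [|r IHr] lt_rn; first by rewrite pid_mx_0 t0 mxrank0.
  rewrite (pid_mxS F (Ordinal lt_rn)) tD mxrank_add_orth_idem -?tM.
  - by rewrite tE IHr 1?ltnW // mulSn addnC.
  - by rewrite pid_mx_id // ltnW.
  - by rewrite mul_delta_mx.
  - suff -> : pid_mx r *m delta_mx (Ordinal lt_rn) (Ordinal lt_rn) = 0 :> 'M[F]_n.+1
      by [].
    apply/matrixP=> a b; rewrite !mxE big1 // => i _; rewrite !mxE -!val_eqE /=.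
    case: (altP (i =P r :> nat)) => [->|]; rewrite ?mulr0 //.
    by case: (altP (a =P r :> nat)) => [->|]; rewrite ?ltnn ?andbF ?mul0r.
  - suff -> : delta_mx (Ordinal lt_rn) (Ordinal lt_rn) *m pid_mx r = 0 :> 'M[F]_n.+1
      by [].
    apply/matrixP=> a b; rewrite !mxE big1 // => i _; rewrite !mxE -!val_eqE /=.
    case: (altP (i =P r :> nat)) => [->|]; rewrite ?andbF ?mul0r //.
    by rewrite ltnn andbF mulr0.
have kE : k = (n.+1 * d)%N by rewrite -tpid // pid_mx_1 t1 mxrank1.
rewrite -{1}(mulmx_ebase M) !tM.
rewrite (@mxrank_mulmx_unit _ _ _ (t (invmx (col_ebase M))) _
  (t (invmx (row_ebase M)))); first by rewrite tpid ?rank_leq_row // kE mulnAC mulnA.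
  by rewrite -tM mulVmx ?col_ebase_unit.
by rewrite -tM mulmxV ?row_ebase_unit.
Qed.

(** * Unital matrix subalgebras and the normalized rank *)

Lemma matrix_embedding1 (F : fieldType) (A : algType F) n
    (f : {linear 'M[F]_n -> A}) :
  matrix_embedding f -> range f 1 -> f 1%:M = 1.
Proof.
by move=> [_ fM] [M _ fM1]; rewrite -[LHS]mulr1 -fM1 -fM mul1mx.
Qed.

Lemma range_sub_delta (F : fieldType) (A : algType F) n m
    (f : {linear 'M[F]_n -> A}) (g : {linear 'M[F]_m -> A}) :
  (forall i j, range g (f (delta_mx i j))) -> (range f `<=` range g)%classic.
Proof.
move=> fg _ [M _ <-]; rewrite (matrix_sum_delta M) raddf_sum /=.
have /choice[h hP] : forall ij : 'I_n * 'I_n, exists N, g N = f (delta_mx ij.1 ij.2).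
  by move=> [i j]; have [N _ <-] := fg i j; exists N.
exists (\sum_i \sum_j M i j *: h (i, j)) => //; rewrite raddf_sum /=.
apply: eq_bigr => i _; rewrite !raddf_sum /=.
by apply: eq_bigr => j _; rewrite !linearZ /= hP.
Qed.

Lemma locally_matrix_unital (F : fieldType) (A : algType F) (s : seq A) :
  locally_matrix A ->
  exists n, exists f : {linear 'M[F]_n -> A},
    [/\ (0 < n)%N, matrix_embedding f, f 1%:M = 1
      & forall a, a \in s -> range f a].
Proof.
move=> lmA; have [n [f [n_gt0 f_emb fP]]] := lmA (1 :: s).
exists n, f; split=> // [|a sa]; last by apply: fP; rewrite inE sa orbT.
by apply: matrix_embedding1 => //; apply: fP; rewrite inE eqxx.
Qed.

(** The range of [f] is spanned by finitely many images of matrix units, so local matricity applied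
    to these together with [s] captures all of it. *)
Lemma locally_matrix_extend (F : fieldType) (A : algType F) n
    (f : {linear 'M[F]_n -> A}) (s : seq A) :
  locally_matrix A ->
  exists m, exists g : {linear 'M[F]_m -> A},
    [/\ (0 < m)%N, matrix_embedding g, g 1%:M = 1, (range f `<=` range g)%classic
      & forall a, a \in s -> range g a].
Proof.
move=> lmA; have [m [g [m_gt0 g_emb g1 gP]]] := locally_matrix_unital
  (s ++ [seq f (delta_mx i j) | i <- enum 'I_n, j <- enum 'I_n]) lmA.
exists m, g; split=> //; last by move=> a sa; apply: gP; rewrite mem_cat sa.
apply: range_sub_delta => i j; apply: gP; rewrite mem_cat orbC.
by rewrite (allpairs_f (fun i j => f (delta_mx i j))) ?mem_enum.
Qed.

Lemma mxrank_sub_range (F : fieldType) (A : algType F) n m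
    (f : {linear 'M[F]_n -> A}) (g : {linear 'M[F]_m -> A}) (M : 'M_n) (N : 'M_m) :
  matrix_embedding f -> matrix_embedding g -> f 1%:M = 1 -> g 1%:M = 1 ->
  (range f `<=` range g)%classic -> f M = g N ->
  (n * \rank N = m * \rank M)%N.
Proof.
move=> [_ fM] [g_inj gM] f1 g1 fg fMgN.
(* The inclusion of ranges is read as a map [t] between matrix algebras with [g (t M) = f M];
   injectivity of [g] makes it unital, additive and multiplicative. *)
have /choice[t tP] : forall M, exists N, g N = f M.
  by move=> M'; have [|N' _ <-] := fg (f M'); [exists M' | exists N'].
have -> : N = t M by apply: g_inj; rewrite tP.
apply: mxrank_unital_morph => [M1 M2|M1 M2|]; apply: g_inj.
- by rewrite raddfD /= !tP raddfD.
- by rewrite gM !tP fM.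
- by rewrite tP f1 g1.
Qed.

Lemma nrankE (F : fieldType) (A : algType F) n (f : {linear 'M[F]_n -> A}) M :
  locally_matrix A -> (0 < n)%N -> matrix_embedding f -> f 1%:M = 1 ->
  nrank (f M) = (\rank M)%:R / n%:R.
Proof.
move=> lmA n_gt0 f_emb f1; rewrite /nrank; case: xgetP => [q _|]; last first.
  move/(_ ((\rank M)%:R / n%:R)) => [].
  by exists n, f, M; split=> //; exists 1%:M.
case=> m [g [N [m_gt0 g_emb /(matrix_embedding1 g_emb) g1 gN ->]]].
(* The embedding [g] behind the chosen value need not be comparable with [f]; both are compared with
   an [h] whose range contains both ranges. *)
have [k [h [k_gt0 h_emb h1 fh hP]]] :=
  locally_matrix_extend f [seq g (delta_mx i j) | i <- enum 'I_m, j <- enum 'I_m] lmA.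
have gh : (range g `<=` range h)%classic.
  apply: range_sub_delta => i j; apply: hP.
  by rewrite (allpairs_f (fun i j => g (delta_mx i j))) ?mem_enum.
have [|K _ hK] := fh (f M); first by exists M.
have e1 := mxrank_sub_range f_emb h_emb f1 h1 fh (esym hK).
have e2 := mxrank_sub_range g_emb h_emb g1 h1 gh (etrans gN (esym hK)).
have nz x : (0 < x)%N -> x%:R != 0 :> rat by rewrite Num.Theory.pnatr_eq0 -lt0n.
apply/eqP; rewrite GRing.eqr_div ?nz // -!natrM Num.Theory.eqr_nat.
rewrite -(eqn_pmul2l k_gt0) !mulnA -e1 -e2.
by apply/eqP; rewrite mulnAC [RHS]mulnAC (mulnC m n).
Qed.

Lemma nrank1 (F : fieldType) (A : algType F) :
  locally_matrix A -> nrank (1 : A) = 1.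
Proof.
move=> lmA; have [n [f [n_gt0 f_emb f1 _]]] := locally_matrix_unital [::] lmA.
by rewrite -f1 nrankE // mxrank1 divff // Num.Theory.pnatr_eq0 -lt0n.
Qed.

Lemma nrank1_invertible (F : fieldType) (A : algType F) (a : A) :
  locally_matrix A -> nrank a = 1 -> invertible a.
Proof.
move=> lmA; have [n [f [n_gt0 f_emb f1 fa]]] := locally_matrix_unital [:: a] lmA.
have {fa}[|M _ <-] := fa a; first by rewrite inE.
have nz : n%:R != 0 :> rat by rewrite Num.Theory.pnatr_eq0 -lt0n.
rewrite nrankE // => /(canRL (divfK nz))/eqP.
rewrite mul1r Num.Theory.eqr_nat => /eqP rkM.
have uM : M \in unitmx by rewrite -row_free_unit /row_free rkM.
by exists (f (invmx M)); rewrite -!f_emb.2 mulmxV // mulVmx.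
Qed.

Lemma nrank_idem_compl (F : fieldType) (A : algType F) (a : A) :
  locally_matrix A -> a * a = a -> nrank a + nrank (1 - a) = 1.
Proof.
move=> lmA; have [n [f [n_gt0 f_emb f1 fa]]] := locally_matrix_unital [:: a] lmA.
have {fa}[|M _ <-] := fa a; first by rewrite inE.
have nz : n%:R != 0 :> rat by rewrite Num.Theory.pnatr_eq0 -lt0n.
rewrite -f_emb.2 => /f_emb.1 MM.
by rewrite -f1 -raddfB !nrankE // -mulrDl -natrD mxrank_idem_compl // divff.
Qed.

(* If [w] is the inverse of [u], the ranks of [a] and [u - a] are those of
   [a w] and [1 - a w], which are complementary only for idempotents. *)
Lemma idem_of_nrank_compl (F : fieldType) (A : algType F) (a u w : A) :
  locally_matrix A -> u * w = 1 -> w * u = 1 ->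
  nrank a + nrank (u - a) = 1 -> (a * w) * (a * w) = a * w.
Proof.
move=> lmA uw wu.
have [n [f [n_gt0 [f_inj fM] f1 fP]]] := locally_matrix_unital [:: a; u; w] lmA.
have [|M _ fMa] := fP a; first by rewrite !inE eqxx.
have [|U _ fU] := fP u; first by rewrite !inE eqxx ?orbT.
have [|W _ fW] := fP w; first by rewrite !inE eqxx ?orbT.
have nz : n%:R != 0 :> rat by rewrite Num.Theory.pnatr_eq0 -lt0n.
have UW : U *m W = 1%:M by apply: f_inj; rewrite fM fU fW f1.
have WU : W *m U = 1%:M by apply: f_inj; rewrite fM fU fW f1.
rewrite -fMa -fU -fW -raddfB !nrankE // -mulrDl -natrD => /(canRL (divfK nz))/eqP.
rewrite mul1r Num.Theory.eqr_nat => /eqP rk.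
rewrite -!fM idem_of_mxrank_compl // -[RHS]rk.
have rkW (P : 'M[F]_n) : \rank (P *m W) = \rank P.
  by rewrite -{1}(mul1mx P) (mxrank_mulmx_unit _ (mulmx1 _) WU).
by rewrite -UW -mulmxBl !rkW.
Qed.

(** * Jordan matrix units and their Peirce components *)

Definition matrix_units (A : pzRingType) n (E : 'I_n -> 'I_n -> A) : Prop :=
  (forall i j k l, E i j * E k l = E i l *+ (j == k)) /\ \sum_i E i i = 1.

(** These relations hold for the images of matrix units under homomorphisms and under
    antihomomorphisms alike, being insensitive to reversal of the product. *)
Record jordan_units (B : pzRingType) n (x : 'I_n -> 'I_n -> B) : Prop :=
  JordanUnits {
  ju_diag : forall i j, x i i * x j j = x i i *+ (i == j);
  ju_sum : \sum_i x i i = 1;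
  ju_sqr : forall i j, i != j -> x i j * x i j = 0;
  ju_row : forall i j, i != j -> x i i * x i j + x i j * x i i = x i j;
  ju_col : forall i j, i != j -> x j j * x i j + x i j * x j j = x i j;
  ju_opp : forall i j, i != j -> x i j * x j i + x j i * x i j = x i i + x j j;
  ju_path : forall i j k, i != j -> j != k -> i != k ->
    x i j * x j k + x j k * x i j = x i k }.

(** Thanks to this symmetry the antihomomorphic part is the homomorphic part computed in [B^c], and
    its laws come for free. *)
Lemma jordan_units_converse (B : pzRingType) n (x : 'I_n -> 'I_n -> B) :
  jordan_units x -> @jordan_units B^c n x.
Proof.
case=> diag sum sqr row col opp path; split=> //.
- by move=> i j; rewrite -[LHS]/(x j j * x i i) diag eq_sym; case: eqP => [->|].
- by move=> i j ij; rewrite addrC; apply: row.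
- by move=> i j ij; rewrite addrC; apply: col.
- by move=> i j ij; rewrite addrC; apply: opp.
- by move=> i j k ij jk ik; rewrite addrC; apply: path.
Qed.

Section HomPart.
Variables (B : pzRingType) (n : nat).
Implicit Types (x : 'I_n.+2 -> 'I_n.+2 -> B).

(** For [i != j] no right factor [x j j] is needed: [ju_mulr] shows that the product already lies in
    the [(i, j)] Peirce space. *)
Definition peirce x i j : B := x i i * x i j.

Let o1 : 'I_n.+2 := lift ord0 ord0.

(** [peirce x i j] is the wanted unit only off the diagonal. [hom_col x i] and [hom_row x j] play
    the units at [(i, 0)] and [(0, j)], the corner one being the loop from 0 through [o1], so that
    [hom_part] covers all entries uniformly. *)
Definition hom_col x i : B :=
  if i == ord0 then peirce x ord0 o1 * peirce x o1 ord0 else peirce x i ord0.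

Definition hom_row x j : B :=
  if j == ord0 then peirce x ord0 o1 * peirce x o1 ord0 else peirce x ord0 j.

Definition hom_part x i j : B := hom_col x i * hom_row x j.

End HomPart.

Section JordanUnits.
Variables (B : pzRingType) (n : nat) (x : 'I_n.+2 -> 'I_n.+2 -> B).
Hypothesis xJ : jordan_units x.
Local Notation p i := (x i i).
Local Notation f := (peirce x).
Local Notation o1 := (lift ord0 ord0 : 'I_n.+2).

Lemma ju_idem i : p i * p i = p i.
Proof. by rewrite (ju_diag xJ) eqxx. Qed.

Lemma ju_orth i j : i != j -> p i * p j = 0.
Proof. by move=> ij; rewrite (ju_diag xJ) (negPf ij). Qed.

Lemma ju_mulr i j : i != j -> p i * x i j * p j = p i * x i j.
Proof.
move=> ij; have := congr1 ( *%R (p i)) (ju_col xJ ij).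
by rewrite mulrDr !mulrA ju_orth // mul0r add0r.
Qed.

Lemma ju_swap i j : i != j -> x i j * p j = p i * x i j.
Proof.
move=> ij; have := congr1 (fun y => y * p j) (ju_row xJ ij).
rewrite mulrDl -[_ * p i * p j]mulrA ju_orth // mulr0 addr0 => <-.
exact: ju_mulr.
Qed.

Lemma ju_swapC i j : i != j -> p j * x i j = x i j * p i.
Proof.
move=> ij; apply: (addIr (x i j * p j)); rewrite (ju_col xJ ij) -[LHS](ju_row xJ ij).
by rewrite addrC (ju_swap ij).
Qed.

Lemma ju_out_l i j k : k != i -> k != j -> i != j -> p k * x i j = 0.
Proof.
move=> ki kj ij; rewrite -(ju_row xJ ij) mulrDr mulrA ju_orth // mul0r add0r.
by rewrite -ju_swapC // mulrA ju_orth // mul0r.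
Qed.

Lemma peirce_mull i j : p i * f i j = f i j.
Proof. by rewrite mulrA ju_idem. Qed.

Lemma peirce_mulr i j : i != j -> f i j * p j = f i j.
Proof. exact: ju_mulr. Qed.

Lemma peirce_orth i j k l : i != j -> j != k -> f i j * f k l = 0.
Proof.
by move=> ij jk; rewrite -(peirce_mulr ij) -(peirce_mull k) mulrA -[_ * p j * _]mulrA
  ju_orth // mulr0 mul0r.
Qed.

Lemma peirceM i j k : i != j -> j != k -> f i j * f j k = p i * x i j * x j k.
Proof. by move=> ij jk; rewrite /peirce mulrA ju_mulr. Qed.

(** Multiply [ju_path] by [p i] on the left: the reversed term dies because [p i] kills [x j k]. *)
Lemma peirce_path i j k : i != j -> j != k -> i != k -> f i j * f j k = f i k.
Proof.
move=> ij jk ik; rewrite peirceM // /f -(ju_path xJ ij jk ik) mulrDr !mulrA.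
by rewrite (ju_out_l _ _ jk) // mul0r addr0.
Qed.

Lemma peirce_loop i j : i != j -> f i j * f j i + p i * x j i * x i j = p i.
Proof.
move=> ij; rewrite peirceM // 1?eq_sym // -!mulrA -mulrDr (ju_opp xJ ij) mulrDr.
by rewrite ju_idem ju_orth // addr0.
Qed.

(** Expand the left factor of [p i * f i j] by [peirce_loop]; the second summand kills [f i j] since
    [x i j] squares to 0. *)
Lemma peirce_zigzag i j : i != j -> f i j * f j i * f i j = f i j.
Proof.
move=> ij; rewrite -[RHS]peirce_mull -[X in _ = X * _](peirce_loop ij) mulrDl.
suff -> : p i * x j i * x i j * f i j = 0 by rewrite addr0.
by rewrite [f i j]/peirce -(ju_swap ij) mulrA -[_ * x i j * x i j]mulrA
  (ju_sqr xJ ij) mulr0 mul0r.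
Qed.

(** The loop at [i] does not depend on its turning point, because [f i j] factors as
    [f i k * f k j]. This legitimates the fixed choice of [o1]. *)
Lemma peirce_loopE i j k : i != j -> i != k -> f i j * f j i = f i k * f k i.
Proof.
move=> ij ik; have [->//|jk] := eqVneq j k.
by rewrite -(peirce_path ik _ ij) 1?eq_sym // -mulrA peirce_path // eq_sym.
Qed.

Lemma hom_row_col i j :
  hom_row x i * hom_col x j = (f ord0 o1 * f o1 ord0) *+ (i == j).
Proof.
rewrite /hom_row /hom_col; have [-> {i}|i0] := eqVneq i ord0.
  have [_|j0] := eqVneq j ord0; first by rewrite mulrA peirce_zigzag.
  by rewrite -mulrA peirce_orth ?mulr0 // eq_sym.
have [-> {j}|j0] := eqVneq j ord0.
  by rewrite (negPf i0) mulrA peirce_orth ?mul0r // eq_sym.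
have [<- {j j0}|ij] := eqVneq i j; last by rewrite peirce_orth // eq_sym.
by apply: peirce_loopE; rewrite // eq_sym.
Qed.

Lemma hom_colK i : hom_col x i * (f ord0 o1 * f o1 ord0) = hom_col x i.
Proof.
rewrite /hom_col; have [_|i0] := eqVneq i ord0; first by rewrite mulrA peirce_zigzag.
by rewrite (@peirce_loopE ord0 o1 i) 1?eq_sym // mulrA peirce_zigzag.
Qed.

Lemma hom_partM i j k l :
  hom_part x i j * hom_part x k l = hom_part x i l *+ (j == k).
Proof.
rewrite /hom_part mulrA -[_ * hom_row x j * _]mulrA hom_row_col.
by rewrite mulrnAr mulrnAl hom_colK.
Qed.

Lemma hom_part_comp i j k : hom_part x i j * hom_part x j k = hom_part x i k.
Proof. by rewrite hom_partM eqxx. Qed.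

Lemma hom_partE i j : i != j -> hom_part x i j = f i j.
Proof.
move=> ij; rewrite /hom_part; have [i0|i0] := eqVneq i ord0.
  rewrite i0 in ij *; rewrite /hom_col /hom_row eqxx eq_sym (negPf ij).
  by rewrite (@peirce_loopE ord0 o1 j) // peirce_zigzag.
have [-> {j ij}|j0] := eqVneq j ord0.
  by rewrite [hom_row _ _]/hom_row eqxx hom_colK /hom_col (negPf i0).
by rewrite /hom_col /hom_row (negPf i0) (negPf j0) peirce_path // eq_sym.
Qed.

Lemma hom_part_diag i j : i != j -> hom_part x i i = f i j * f j i.
Proof.
move=> ij; rewrite -(hom_partE ij) -hom_partE 1?eq_sym //.
by rewrite hom_part_comp.
Qed.

End JordanUnits.

Section Decomposition.
Variables (B : pzRingType) (n : nat) (x : 'I_n.+2 -> 'I_n.+2 -> B).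
Hypothesis xJ : jordan_units x.
Let xJc := jordan_units_converse xJ.

Definition antihom_part i j : B := @hom_part B^c n x i j.

Lemma antihom_partM i j k l :
  antihom_part i j * antihom_part k l = antihom_part k j *+ (l == i).
Proof. exact: (hom_partM xJc k l i j). Qed.

Lemma antihom_part_comp i j k :
  antihom_part j k * antihom_part i j = antihom_part i k.
Proof. exact: (hom_part_comp xJc). Qed.

Lemma antihom_partE i j : i != j -> antihom_part i j = x i j * x i i.
Proof. exact: (hom_partE xJc). Qed.

Lemma hom_antihom_part_sum i j : hom_part x i j + antihom_part i j = x i j.
Proof.
have [<- {j}|ij] := eqVneq i j; last first.
  by rewrite hom_partE // antihom_partE // (ju_row xJ ij).
have [j ij] : exists j, i != j.
  by exists (lift i ord0); rewrite neq_lift.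
rewrite (hom_part_diag xJ ij) -[RHS](peirce_loop xJ ij); congr (_ + _).
rewrite -(antihom_part_comp i j i).
rewrite !antihom_partE // 1?eq_sym // -(ju_swapC xJ ij) mulrA.
by rewrite -[_ * x j j * x j j]mulrA ju_idem // (ju_swapC xJ) // eq_sym.
Qed.

(** The composition laws allow the outer indices to be replaced at will, so both factors may be
    taken off the diagonal. The product then contains the square of some [x a j] or a product of two
    orthogonal [p]'s. *)
Lemma hom_antihom_part0 i j k l : hom_part x i j * antihom_part k l = 0.
Proof.
suff [a [b E]] : exists a b, hom_part x a j * antihom_part b l = 0.
  rewrite -(hom_part_comp xJ i a j) -(antihom_part_comp k b l).
  by rewrite mulrA -[_ * hom_part x a j * _]mulrA E mulr0 mul0r.
have [a aj] : exists a, a != j by exists (lift j ord0); rewrite eq_sym neq_lift.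
have [b bl] : exists b, b != l by exists (lift l ord0); rewrite eq_sym neq_lift.
have [jl|jl] := eqVneq j l; [exists a, a | exists a, b].
  rewrite -jl hom_partE // antihom_partE // /peirce mulrA -[_ * _ * x a j]mulrA.
  by rewrite (ju_sqr xJ aj) mulr0 mul0r.
rewrite hom_partE // antihom_partE // /peirce -(ju_swap xJ aj) -(ju_swapC xJ bl).
by rewrite mulrA -[_ * x j j * x l l]mulrA ju_orth // mulr0 mul0r.
Qed.

Lemma antihom_hom_part0 i j k l : antihom_part k l * hom_part x i j = 0.
Proof.
suff [a [b E]] : exists a b, antihom_part k b * hom_part x i a = 0.
  rewrite -(hom_part_comp xJ i a j) -(antihom_part_comp k b l).
  by rewrite mulrA -[_ * antihom_part k b * _]mulrA E mulr0 mul0r.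
have [a ai] : exists a, i != a by exists (lift i ord0); rewrite neq_lift.
have [b bk] : exists b, k != b by exists (lift k ord0); rewrite neq_lift.
have [ik|ik] := eqVneq i k; [exists a, a | exists a, b].
  rewrite -ik hom_partE // antihom_partE // /peirce mulrA -[_ * _ * x i i]mulrA.
  rewrite ju_idem // -(ju_swapC xJ ai) -mulrA.
  by rewrite (ju_sqr xJ ai) mulr0.
rewrite hom_partE // antihom_partE // /peirce.
by rewrite mulrA -[_ * x k k * x i i]mulrA ju_orth 1?eq_sym // mulr0 mul0r.
Qed.

End Decomposition.

Lemma jordan_units_decomp (B : pzRingType) n (x : 'I_n.+1 -> 'I_n.+1 -> B) :
  jordan_units x -> exists y z : 'I_n.+1 -> 'I_n.+1 -> B,
  [/\ forall i j, x i j = y i j + z i j,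
      forall i j k l, y i j * y k l = y i l *+ (j == k),
      forall i j k l, z i j * z k l = z k j *+ (l == i),
      forall i j k l, y i j * z k l = 0
    & forall i j k l, z k l * y i j = 0].
Proof.
case: n x => [|n] x xJ; last first.
  exists (hom_part x), (antihom_part x); split.
  - by move=> i j; rewrite hom_antihom_part_sum.
  - exact: hom_partM.
  - exact: antihom_partM.
  - exact: hom_antihom_part0.
  - exact: antihom_hom_part0.
(* In size 1 there is no second index to loop through; the single unit is both homomorphic and
   antihomomorphic, and is put in the first part. *)
exists x, (fun _ _ => 0); split=> *; rewrite ?addr0 ?mulr0 ?mul0r ?mul0rn //.
by rewrite !ord1 (ju_diag xJ).
Qed.

(** * Idempotent preservers send matrix units to Jordan units *)

(** Expanding gives [p * q = - (q * p)]; multiplying by [p] on either side shows that [p] and [q]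
    also commute, so [p * q] is its own opposite. *)
Lemma idem_add_orth (R : pzRingType) (p q : R) :
    (forall b : R, b + b = 0 -> b = 0) ->
  p * p = p -> q * q = q -> (p + q) * (p + q) = p + q -> p * q = 0.
Proof.
move=> double_eq0 pp qq; rewrite mulrDl !mulrDr pp qq => e.
have anti : p * q = - (q * p).
  apply/eqP; rewrite -addr_eq0; apply/eqP; apply: (addrI (p + q)).
  by rewrite addr0 addrACA (addrC q) e.
have comm : p * q = q * p.
  by rewrite -{1}pp -mulrA anti mulrN mulrA anti mulNr opprK -mulrA pp.
by apply: double_eq0; rewrite {2}anti comm subrr.
Qed.

(** Adding the two expanded equations leaves twice [x * x]; once this vanishes, the first one is the
    Peirce relation. *)
Lemma idem_addsub_peirce (R : pzRingType) (p x : R) :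
    (forall b : R, b + b = 0 -> b = 0) ->
    p * p = p -> (p + x) * (p + x) = p + x -> (p - x) * (p - x) = p - x ->
  x * x = 0 /\ p * x + x * p = x.
Proof.
move=> double_eq0 pp + minus.
rewrite mulrDl !mulrDr pp -!addrA => /addrI; rewrite addrA => plus.
move: minus; rewrite mulrDl !mulrDr !mulrN !mulNr opprK pp -!addrA => /addrI.
rewrite addrA -opprD => minus.
have sq0 : x * x = 0.
  apply: double_eq0; rewrite -[RHS](subrr x) -{5}plus -minus addrACA subrr.
  by rewrite add0r.
by split=> //; rewrite -[RHS]plus sq0 addr0.
Qed.

Section JordanProduct.
Variable R : pzRingType.
Implicit Types a b c p q x y : R.

Definition jordan a b := a * b + b * a.

Lemma jordanC a b : jordan a b = jordan b a.
Proof. exact: addrC. Qed.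

Lemma jordanDl a b c : jordan (a + b) c = jordan a c + jordan b c.
Proof. by rewrite /jordan mulrDl mulrDr addrACA. Qed.

Lemma jordanDr a b c : jordan c (a + b) = jordan c a + jordan c b.
Proof. by rewrite !(jordanC c) jordanDl. Qed.

Lemma jordanNr a c : jordan c (- a) = - jordan c a.
Proof. by rewrite /jordan mulrN mulNr opprD. Qed.

Lemma jordan_opp p q x y :
    p * p = p -> jordan p q = 0 -> x * x = 0 ->
    jordan p x = x -> jordan q x = x -> jordan p y = y ->
    jordan (p + x) (y + q - p - x) = y + q - p - x ->
  jordan x y = p + q.
Proof.
move=> pp pq xx px qx py; rewrite jordanDl !jordanDr !jordanNr.
rewrite pq px py (jordanC x q) (jordanC x p) px qx addr0.
have -> : jordan x x = 0 by rewrite /jordan xx addr0.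
have -> : jordan p p = p + p by rewrite /jordan pp.
rewrite oppr0 addr0 addrK => e; apply: (addrI (y - (p + p) - x)); rewrite e.
by rewrite opprD !addrA [_ - x + p]addrAC subrK !(addrAC _ q).
Qed.

End JordanProduct.

Section IdempotentPreserver.
Variables (F : fieldType) (A B : algType F) (psi : {linear A -> B}).
Hypothesis char_neq2 : 2%N \notin [pchar F].
Hypothesis psi_idem : forall a, a * a = a -> psi a * psi a = psi a.

(** The only place where the characteristic enters. *)
Lemma double_eq0 (b : B) : b + b = 0 -> b = 0.
Proof.
have nz2 : 2%:R != 0 :> F by move: char_neq2; rewrite inE /=.
by move=> bb; rewrite -[b]scale1r -(mulVf nz2) -scalerA scaler_nat (mulr2n b) bb scaler0.
Qed.

Lemma idem_preserver_orth a b :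
  a * a = a -> b * b = b -> a * b = 0 -> b * a = 0 -> psi a * psi b = 0.
Proof.
move=> aa bb ab ba.
apply: idem_add_orth; [exact: double_eq0|exact: psi_idem|exact: psi_idem|].
rewrite -raddfD; apply: psi_idem.
by rewrite mulrDl !mulrDr aa bb ab ba addr0 add0r.
Qed.

Lemma idem_preserver_peirce a c :
  a * a = a -> c * c = 0 -> a * c + c * a = c ->
  psi c * psi c = 0 /\ psi a * psi c + psi c * psi a = psi c.
Proof.
move=> aa cc ac; apply: idem_addsub_peirce.
- exact: double_eq0.
- exact: psi_idem.
- rewrite -raddfD; apply: psi_idem.
  by rewrite mulrDl !mulrDr aa cc addr0 -addrA ac.
rewrite -raddfB; apply: psi_idem.
rewrite mulrDl !mulrDr !mulrN !mulNr aa cc oppr0 subr0 -addrA -opprD.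
by rewrite ac.
Qed.

Section MatrixUnits.
Variables (n : nat) (E : 'I_n -> 'I_n -> A).
Hypothesis EM : matrix_units E.
Hypothesis psi1 : psi 1 = 1.

Let EE i j k : E i j * E j k = E i k.
Proof. by rewrite EM.1 eqxx. Qed.
Let E0 i j k l : j != k -> E i j * E k l = 0.
Proof. by move=> jk; rewrite EM.1 (negPf jk). Qed.

Lemma idem_preserver_jordan_units : jordan_units (fun i j => psi (E i j)).
Proof.
have row i j : i != j -> psi (E i j) * psi (E i j) = 0 /\
    psi (E i i) * psi (E i j) + psi (E i j) * psi (E i i) = psi (E i j).
  move=> ij; apply: idem_preserver_peirce; rewrite ?EE ?E0 ?addr0 // eq_sym //.
have col i j : i != j ->
    psi (E j j) * psi (E i j) + psi (E i j) * psi (E j j) = psi (E i j).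
  move=> ij; have [|||//] := @idem_preserver_peirce (E j j) (E i j).
  - by rewrite EE.
  - by rewrite E0 // eq_sym.
  - by rewrite EE E0 ?add0r // eq_sym.
split.
- move=> i j; have [<-|ij] := eqVneq i j; first by rewrite psi_idem ?EE.
  by apply: idem_preserver_orth; rewrite ?EE ?E0 // eq_sym.
- by rewrite -raddf_sum EM.2.
- by move=> i j ij; case: (row i j ij).
- by move=> i j ij; case: (row i j ij).
- exact: col.
- move=> i j ij; have ji : j != i by rewrite eq_sym.
  have [xx px] := row i j ij; have [yy _] := row j i ji.
  apply: jordan_opp px (col i j ij) (col j i ji) _ => //.
  - by rewrite psi_idem ?EE.
  - rewrite /jordan !idem_preserver_orth ?addr0 //; by rewrite ?EE ?E0.
  (* [a] is an idempotent and [c] equals [(1 - a) * E j i * a], hence [c * a = c], [a * c = 0] and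
     [c * c = 0]. Expanding the Jordan product of the images isolates that of [psi (E i j)] and
     [psi (E j i)]. *)
  set a := E i i + E i j; set c := E j i + E j j - E i i - E i j.
  have ac : a * c = 0.
    rewrite /a /c !mulrDl !mulrDr !mulrN !EE !E0 // !addr0 !add0r !oppr0 !addr0.
    by rewrite -opprD addNr.
  have ca : c * a = c.
    by rewrite /a /c !mulrDl !mulrDr !mulNr !EE !E0 // !oppr0 !addr0 addrA.
  have : jordan (psi a) (psi c) = psi c.
    apply: (idem_preserver_peirce _ _ _).2.
    - by rewrite /a mulrDl !mulrDr !EE !E0 // !addr0.
    - by rewrite -{1}ca -mulrA ac mulr0.
    - by rewrite ac ca add0r.
  by rewrite /a /c !raddfB !raddfD.
(* The Peirce relation for the idempotent [E j j + E i j] and the square-zero [E i k + E j k] has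
   four Jordan terms. Two vanish ([xx0], [px0]), one is [psi (E j k)], and the last is the wanted
   product. *)
- move=> i j k ij jk ik.
  have [ji kj ki] : [/\ j != i, k != j & k != i] by rewrite !(eq_sym _ i) (eq_sym k).
  have [ij0 _] := row i j ij; have [ik0 _] := row i k ik.
  have xx0 : jordan (psi (E i j)) (psi (E i k)) = 0.
    have : psi (E i j + E i k) * psi (E i j + E i k) = 0.
      apply: (@idem_preserver_peirce (E i i) _ _ _ _).1.
      - by rewrite EE.
      - by rewrite mulrDl !mulrDr !E0 // !addr0.
      - by rewrite mulrDl !mulrDr !EE !E0 // !addr0.
    by rewrite raddfD mulrDl !mulrDr ij0 ik0 add0r addr0.
  have px0 : jordan (psi (E j j)) (psi (E i k)) = 0.
    have idem : (E i i + E i k) * (E i i + E i k) = E i i + E i k.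
      by rewrite mulrDl !mulrDr !EE !E0 // !addr0.
    have pi0 : psi (E j j) * psi (E i i) = 0 /\ psi (E i i) * psi (E j j) = 0.
      by split; apply: idem_preserver_orth; rewrite ?EE ?E0.
    have l0 : psi (E j j) * psi (E i i + E i k) = 0.
      by apply: idem_preserver_orth; rewrite ?EE // ?mulrDl ?mulrDr !E0 // addr0.
    have r0 : psi (E i i + E i k) * psi (E j j) = 0.
      by apply: idem_preserver_orth; rewrite ?EE // ?mulrDl ?mulrDr !E0 // addr0.
    move: l0 r0; rewrite raddfD mulrDl mulrDr pi0.1 pi0.2 !add0r /jordan => -> ->.
    by rewrite addr0.
  have : jordan (psi (E j j + E i j)) (psi (E i k + E j k)) = psi (E i k + E j k).
    apply: (idem_preserver_peirce _ _ _).2.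
    - by rewrite mulrDl !mulrDr !EE !E0 // !addr0.
    - by rewrite mulrDl !mulrDr !E0 // !addr0.
    - by rewrite !mulrDl !mulrDr !EE !E0 // !addr0 !add0r addrC.
  rewrite !raddfD jordanDl !jordanDr xx0 px0 !add0r.
  rewrite {1}/jordan (row j k jk).2 addrC; exact: addIr.
Qed.

End MatrixUnits.
End IdempotentPreserver.

(** * Splitting idempotents, first on matrix subalgebras and then on [A] *)

(** The set [S] lets splittings over different subalgebras be compared. As [e] commutes with [psi]
    on [S], the last two fields say that [e * psi] is multiplicative and [(1 - e) * psi]
    antimultiplicative there. *)
Record splits (F : fieldType) (A B : algType F) (S : set A) (psi : A -> B)
    (e : B) : Prop := Splits {
  splits_idem : e * e = e;
  splits_comm : forall a, S a -> e * psi a = psi a * e;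
  splits_hom : forall a b, S a -> S b -> e * psi (a * b) = e * psi a * psi b;
  splits_antihom : forall a b, S a -> S b ->
    (1 - e) * psi (a * b) = (1 - e) * psi b * psi a }.

Lemma splits_sub (F : fieldType) (A B : algType F) (S T : set A)
    (psi : A -> B) e :
  (S `<=` T)%classic -> splits T psi e -> splits S psi e.
Proof. by move=> ST [idem comm hom antihom]; split=> // *; auto. Qed.

(* A splitting idempotent is determined by its products with the diagonal
   matrix units, which [psi] determines as soon as there are two of them. *)
Lemma splits_uniq (F : fieldType) (A B : algType F) (S : set A)
    (psi : {linear A -> B}) n (E : 'I_n.+2 -> 'I_n.+2 -> A) e e' :
  psi 1 = 1 -> matrix_units E -> (forall i j, S (E i j)) ->
  splits S psi e -> splits S psi e' -> e = e'.
Proof.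
move=> psi1 EM SE.
suff diag e0 i j : i != j -> splits S psi e0 ->
    e0 * psi (E i i) = psi (E i i) * (psi (E i j) * psi (E j i)).
  move=> eS e'S; rewrite -[e]mulr1 -[e']mulr1 -psi1 -EM.2 raddf_sum !mulr_sumr.
  apply: eq_bigr => i _; have ij : i != lift i ord0 by rewrite neq_lift.
  by rewrite !(diag _ _ _ ij).
move=> ij [idem comm hom antihom].
(* The [e0] part multiplies in the given order and the [1 - e0] part in reverse. Multiplying by
   [psi (E i i)] removes the second term, so [e0 * psi (E i i)] is given by an expression free of
   [e0]. *)
have -> : psi (E i j) * psi (E j i) =
    e0 * psi (E i i) + (1 - e0) * psi (E j j).
  have EE k l m : E k l * E l m = E k m by rewrite EM.1 eqxx.
  rewrite -(EE i j i) -(EE j i j) hom // antihom // -!mulrA -mulrDl.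
  by rewrite addrC subrK mul1r.
rewrite mulrDr !mulrA -comm // mulrBr mulr1 -comm // -hom //.
rewrite -{2}[psi (E i i)]mul1r -mulrBl -antihom // !EM.1 eqxx eq_sym (negPf ij).
by rewrite raddf0 mulr0 addr0.
Qed.

Lemma matrix_linear_ind (R : nzRingType) m n (P : 'M[R]_(m, n) -> Prop) :
  P 0 -> (forall a M N, P M -> P N -> P (a *: M + N)) ->
  (forall i j, P (delta_mx i j)) -> forall M, P M.
Proof.
move=> P0 PD Pdelta M; rewrite (matrix_sum_delta M).
have PZ a N : P N -> P (a *: N) by move=> PN; rewrite -[_ *: _]addr0; apply: PD.
have PA N N' : P N -> P N' -> P (N + N').
  by move=> PN PN'; rewrite -[N]scale1r; apply: PD.
by apply: big_ind => // i _; apply: big_ind => // j _; apply: PZ.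
Qed.

Lemma matrix_units_embedding (F : fieldType) (A : algType F) n
    (f : {linear 'M[F]_n -> A}) :
  matrix_embedding f -> f 1%:M = 1 -> matrix_units (fun i j => f (delta_mx i j)).
Proof.
move=> [_ fM] f1; split=> [i j k l|].
  by rewrite -fM mul_delta_mx_cond raddfMn.
by rewrite -raddf_sum -mx1_sum_delta.
Qed.

Lemma splits_range (F : fieldType) (A B : algType F) (psi : {linear A -> B}) n
    (f : {linear 'M[F]_n.+1 -> A}) :
  2%N \notin [pchar F] -> (forall a, a * a = a -> psi a * psi a = psi a) ->
  psi 1 = 1 -> matrix_embedding f -> f 1%:M = 1 ->
  exists e, splits (range f) psi e.
Proof.
move=> char_neq2 psi_idem psi1 f_emb f1.
have EM := matrix_units_embedding f_emb f1.
have xJ := idem_preserver_jordan_units char_neq2 psi_idem EM psi1.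
have [y [z [xE yM zM yz zy]]] := jordan_units_decomp xJ.
pose x i j := psi (f (delta_mx i j)).
have {}xE i j : x i j = y i j + z i j := xE i j.
(* [e] fixes every [y i j] and kills every [z i j] on both sides, so it cuts [x] into [y] and [z].
   The splitting laws then hold on matrix units and extend by linearity in each argument. *)
pose e := \sum_i y i i.
have ey i j : e * y i j = y i j.
  rewrite /e mulr_suml (bigD1 i) //= yM eqxx big1 ?addr0 // => k ki.
  by rewrite yM (negPf ki).
have ye i j : y i j * e = y i j.
  rewrite /e mulr_sumr (bigD1 j) //= yM eqxx big1 ?addr0 // => k kj.
  by rewrite yM eq_sym (negPf kj).
have ez i j : e * z i j = 0 by rewrite mulr_suml big1.
have ze i j : z i j * e = 0 by rewrite mulr_sumr big1.
have ex i j : e * x i j = y i j by rewrite xE mulrDr ey ez addr0.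
have xe i j : x i j * e = y i j by rewrite xE mulrDl ye ze addr0.
have cx i j : (1 - e) * x i j = z i j by rewrite mulrBl mul1r ex xE addrC addKr.
have xM i j k l : f (delta_mx i j) * f (delta_mx k l) = f (delta_mx i l) *+ (j == k).
  exact: EM.1.
exists e; split.
- by rewrite {2}/e mulr_sumr; apply: eq_bigr => i _; rewrite ey.
- move=> _ [M _ <-]; elim/matrix_linear_ind: M => [|a M N IHM IHN|i j].
  + by rewrite !raddf0 mulr0 mul0r.
  + by rewrite !linearP /= mulrDr mulrDl -scalerAr -scalerAl IHM IHN.
  + by rewrite ex xe.
- move=> _ _ [M _ <-] [N _ <-].
  elim/matrix_linear_ind: M => [|a M M' IHM IHM'|i j].
  + by rewrite !raddf0 mul0r !raddf0 mulr0 mul0r.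
  + rewrite linearP /= mulrDl -scalerAl !linearP /= !mulrDr mulrDl.
    by rewrite -!scalerAr -scalerAl IHM IHM'.
  elim/matrix_linear_ind: N => [|a M M' IHM IHM'|k l].
  + by rewrite !raddf0 mulr0 !raddf0 !mulr0.
  + rewrite linearP /= mulrDr -scalerAr !linearP /= !mulrDr.
    by rewrite -!scalerAr IHM IHM'.
  rewrite xM raddfMn /= mulrnAr [e * _]ex [e * _]ex [psi _]xE mulrDr yz yM.
  by rewrite addr0.
- move: (1 - e) cx => c cx _ _ [M _ <-] [N _ <-].
  elim/matrix_linear_ind: M => [|a M M' IHM IHM'|i j].
  + by rewrite !raddf0 mul0r !raddf0 !mulr0.
  + rewrite linearP /= mulrDl -scalerAl !linearP /= !mulrDr.
    by rewrite -!scalerAr IHM IHM'.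
  elim/matrix_linear_ind: N => [|a M M' IHM IHM'|k l].
  + by rewrite !raddf0 mulr0 !raddf0 !mulr0 mul0r.
  + rewrite linearP /= mulrDr -scalerAr !linearP /= !mulrDr mulrDl.
    by rewrite -!scalerAr -scalerAl IHM IHM'.
  rewrite xM raddfMn /= mulrnAr [c * _]cx [c * _]cx [psi _]xE mulrDr.
  by rewrite zy zM add0r eq_sym.
Qed.

Lemma splits_locally_matrix (F : fieldType) (A B : algType F)
    (psi : {linear A -> B}) :
  2%N \notin [pchar F] -> locally_matrix A ->
  (forall a, a * a = a -> psi a * psi a = psi a) -> psi 1 = 1 ->
  exists e, splits setT psi e.
Proof.
move=> char_neq2 lmA psi_idem psi1.
have [[n [f [f_emb f1]]]|small] := pselect (exists n,
    exists f : {linear 'M[F]_n.+2 -> A}, matrix_embedding f /\ f 1%:M = 1).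
  have [e eS] := splits_range char_neq2 psi_idem psi1 f_emb f1.
  (* Two elements always lie in a subalgebra containing the range of [f]; its own splitting
     idempotent also splits that range, hence equals [e] by uniqueness. *)
  have loc a b : exists S, [/\ splits S psi e, S a & S b].
    have [[|m] [g [// _ g_emb g1 fg gab]]] := locally_matrix_extend f [:: a; b] lmA.
    have [e' e'S] := splits_range char_neq2 psi_idem psi1 g_emb g1.
    exists (range g); split; [|by apply: gab; rewrite !inE eqxx ?orbT..].
    suff -> : e = e' by [].
    apply: (splits_uniq psi1 (matrix_units_embedding f_emb f1) _ eS).
      by move=> i j; exists (delta_mx i j).
    exact: splits_sub fg e'S.
  exists e; split=> [|a _|a b _ _|a b _ _]; first exact: splits_idem eS.
  - by have [S [SS Sa _]] := loc a a; apply: splits_comm SS _ Sa.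
  - by have [S [SS Sa Sb]] := loc a b; apply: splits_hom SS _ _ Sa Sb.
  - by have [S [SS Sa Sb]] := loc a b; apply: splits_antihom SS _ _ Sa Sb.
(* Without a unital matrix subalgebra of size at least 2, [A] consists of scalars and [e = 1] splits
   trivially. *)
have scalar (a : A) : exists c, a = c *: 1.
  have [[|[|n]] [f [// _ f_emb f1 fa]]] := locally_matrix_unital [:: a] lmA; last first.
    by case: small; exists n, f.
  have [|M _ <-] := fa a; first by rewrite inE.
  by exists (M 0 0); rewrite -f1 -linearZ /= scalemx1 -mx11_scalar.
exists 1; split=> [|a _|a b _ _|a b _ _]; rewrite ?subrr ?mul0r ?mulr1 ?mul1r //.
by have [c ->] := scalar a; rewrite -scalerAl mul1r !linearZ /= psi1 -scalerAl mul1r.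
Qed.

(** * Assembly of the decomposition *)

Theorem theorem1 (F : fieldType) (char_neq2 : 2%N \notin [pchar F])
    (A B : algType F) (lmA : locally_matrix A) (lmB : locally_matrix B)
    (phi : {linear A -> B}) (phi_nrank : preserves_nrank phi) :
  exists (e1 e2 : B) (phi1 phi2 : {linear A -> B}) (X Y : B),
    (orthogonal_idempotents e1 e2 /\ e1 + e2 = 1) /\
    (corner_hom e1 phi1 /\ phi1 1 = e1) /\
    (corner_antihom e2 phi2 /\ phi2 1 = e2) /\
    (invertible X /\ invertible Y) /\
    (forall a : A, phi a = X * (phi1 a + phi2 a) * Y).
Proof.
have [w [uw wu]] : invertible (phi 1).
  by apply: nrank1_invertible; rewrite // phi_nrank nrank1.
pose psi : {linear A -> B} := w \o* phi.
have psi1 : psi 1 = 1 by [].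
have psi_idem a : a * a = a -> psi a * psi a = psi a.
  move=> aa; apply: (idem_of_nrank_compl lmB uw wu).
  by rewrite -raddfB !phi_nrank nrank_idem_compl.
have [e [ee ecomm ehom eanti]] := splits_locally_matrix char_neq2 lmA psi_idem psi1.
have ce : (1 - e) * e = 0 by rewrite mulrBl mul1r ee subrr.
have ec : e * (1 - e) = 0 by rewrite mulrBr mulr1 ee subrr.
have cc : (1 - e) * (1 - e) = 1 - e by rewrite mulrBr mulr1 ce subr0.
have ccomm a : (1 - e) * psi a = psi a * (1 - e).
  by rewrite mulrBl mulrBr mul1r mulr1 ecomm.
(* Since [phi a = psi a * phi 1], the normalization is undone on the right alone: [X] is 1 and [Y]
   is [phi 1]. *)
exists e, (1 - e), (e \*o psi), ((1 - e) \*o psi), 1, (phi 1).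
split; first by split; [split | rewrite addrC subrK].
split; first split.
- split=> [a|a b /=]; first by exists (psi a) => //=; rewrite -mulrA -ecomm // mulrA ee.
  by rewrite ehom // [RHS]mulrA -[e * psi a * e]mulrA -ecomm // mulrA ee.
- by rewrite -[RHS]mulr1 -psi1.
split; first split.
- split=> [a|a b /=]; first by exists (psi a) => //=; rewrite -mulrA -ccomm mulrA cc.
  by rewrite eanti // [RHS]mulrA -[(1 - e) * psi b * (1 - e)]mulrA -ccomm mulrA cc.
- by rewrite -[RHS]mulr1 -psi1.
split; first by split; [exists 1; rewrite mulr1 | exists w].
by move=> a; rewrite mul1r /= -mulrDl addrC subrK mul1r -mulrA wu mulr1.
Qed.
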